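(* Let $p$ be a partial metric type on a set $X$ and let $T:X\to X$ be a self mapping such that, for some integer $n>1$ and some real $K$ with $0<K<1$, $$p(T^nx,T^ny)\leq K\,p(x,y)\quad\text{for all }x,y\in X.$$ Let $\lambda$ be a nonnegative real number such that $K^{1/n}<\frac{1}{\lambda}<1$. Then the map $p':X\times X\to[0,\infty)$ defined by $$p'(x,y)=\sum_{i=0}^{n-1}\lambda^i\,p(T^ix,T^iy),\qquad x,y\in X,$$ satisfies: (i) $p'$ is a partial metric type on $X$; (ii) $p'(Tx,Ty)\leq\frac{1}{\lambda}\,p'(x,y)$ for all $x,y\in X$.
   Context: A partial metric type on a set $X$ is a function $p:X\times X\to[0,\infty)$ such that: (pm1) for all $x,y\in X$, $x=y$ if and only if $p(x,x)=p(x,y)=p(y,y)$; (pm2) $0\leq p(x,x)\leq p(x,y)$ for all $x,y\in X$; (pm3) $p(x,y)=p(y,x)$ for all $x,y\in X$; (pm4) there exists a real number $s\geq1$ such that $p(x,y)+p(z,z)\leq s[p(x,z)+p(z,y)]$ for all $x,y,z\in X$. Here $T^i$ denotes the $i$-th iterate of $T$, with $T^0$ the identity. *)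

(* Defs.v *)
From mathcomp Require Import all_boot all_order all_algebra.
From mathcomp Require Import all_classical all_reals all_analysis.

Set Implicit Arguments.
Unset Strict Implicit.
Unset Printing Implicit Defensive.

Import Order.TTheory GRing.Theory Num.Theory.
Local Open Scope ring_scope.

(* The field [pmt_ge0] expresses that the codomain is [0, +oo). *)
Record partial_metric_type (R : realType) (X : Type) (p : X -> X -> R) : Prop :=
  PartialMetricType {
    pmt_ge0 : forall x y, 0 <= p x y;
    pm1 : forall x y, x = y <-> (p x x = p x y /\ p x y = p y y);
    pm2 : forall x y, 0 <= p x x /\ p x x <= p x y;
    pm3 : forall x y, p x y = p y x;
    pm4 : exists s : R, 1 <= s /\
      forall x y z, p x y + p z z <= s * (p x z + p z y)
  }.

Definition weighted_orbit_sum (R : realType) (X : Type) (p : X -> X -> R)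
    (T : X -> X) (n : nat) (lambda : R) (x y : X) : R :=
  \sum_(0 <= i < n) lambda ^+ i * p (iter i T x) (iter i T y).

(* Main.v *)
Require Import Defs.
From mathcomp Require Import all_boot all_order all_algebra.
From mathcomp Require Import all_classical all_reals all_analysis.

Set Implicit Arguments.
Unset Strict Implicit.
Unset Printing Implicit Defensive.

Import Order.TTheory GRing.Theory Num.Theory.
Local Open Scope ring_scope.

(* Multiplying [weighted_orbit_sum] at [(T x, T y)] by [lambda] shifts the
   weighted sequence [lambda ^+ i * p (T^i x) (T^i y)] by one index, so the
   contraction estimate only compares its [0]-th and [n]-th terms:
   [lambda ^+ n * p (T^n x) (T^n y) <= lambda ^+ n * K * p x y <= p x y]. *)

Lemma weighted_orbit_sum_shift (R : realType) (X : Type) (p : X -> X -> R)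
    (T : X -> X) (n : nat) (lambda : R) (x y : X) :
  lambda * weighted_orbit_sum p T n lambda (T x) (T y) + p x y =
  weighted_orbit_sum p T n lambda x y +
    lambda ^+ n * p (iter n T x) (iter n T y).
Proof.
rewrite /weighted_orbit_sum -big_nat_recr //= big_nat_recl //= expr0 mul1r.
rewrite addrC mulr_sumr; congr (_ + _).
by apply: eq_bigr => i _; rewrite exprS mulrA -!iterSr.
Qed.

(** The tail of [f] sums to at most the tail of [g], so equal totals force [g 0 <= f 0]. *)
Lemma eq_sum_head (R : numDomainType) (n : nat) (f g : nat -> R) :
  (0 < n)%N -> (forall i, f i <= g i) ->
  \sum_(0 <= i < n) f i = \sum_(0 <= i < n) g i -> f 0%N = g 0%N.
Proof.
move=> n0 fg; rewrite !(big_ltn n0) => e.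
apply/eqP; rewrite eq_le fg /= -(lerD2r (\sum_(1 <= i < n) f i)) e.
by rewrite lerD2l ler_sum.
Qed.

(** The weights are nonnegative, so (pm2), (pm3) and (pm4) pass to the sum term by term. For (pm1),
    [eq_sum_head] brings equalities of sums down to index 0, where the weight is 1 and (pm1) for [p]
    applies. *)
Lemma partial_metric_type_weighted_orbit_sum (R : realType) (X : Type)
    (p : X -> X -> R) (T : X -> X) (n : nat) (lambda : R) :
  partial_metric_type p -> (0 < n)%N -> 0 <= lambda ->
  partial_metric_type (weighted_orbit_sum p T n lambda).
Proof.
move=> hp n0 l0.
have li i : 0 <= lambda ^+ i by exact: exprn_ge0.
have ge0 x y : 0 <= weighted_orbit_sum p T n lambda x y.
  by apply: sumr_ge0 => i _; rewrite mulr_ge0 // (pmt_ge0 hp).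
have term_le x y i : lambda ^+ i * p (iter i T x) (iter i T x) <=
                     lambda ^+ i * p (iter i T x) (iter i T y).
  by rewrite ler_wpM2l // (pm2 hp _ _).2.
have sym x y : weighted_orbit_sum p T n lambda x y =
               weighted_orbit_sum p T n lambda y x.
  by apply: eq_bigr => i _; rewrite (pm3 hp).
have head_eq x y : weighted_orbit_sum p T n lambda x x =
    weighted_orbit_sum p T n lambda x y -> p x x = p x y.
  by move=> /(eq_sum_head n0 (term_le x y)); rewrite !expr0 !mul1r.
split=> //.
- move=> x y; split=> [-> //|[xx yy]]; apply/(pm1 hp); split.
    exact: head_eq.
  by rewrite (pm3 hp); apply/esym/head_eq; rewrite -yy sym.
- by move=> x y; split=> //; apply: ler_sum => i _.
(* The constant [s] of [p] does not depend on the points, so it serves every iterate and hence the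
   whole sum. *)
- have [s [s1 hs]] := pm4 hp; exists s; split=> // x y z.
  rewrite /weighted_orbit_sum -!big_split /= mulr_sumr.
  by apply: ler_sum => i _; rewrite -!mulrDr mulrCA ler_wpM2l.
Qed.

Theorem theorem2p5 (R : realType) (X : Type) (p : X -> X -> R) (T : X -> X)
    (n : nat) (K lambda : R)
    (hp : partial_metric_type p)
    (hn : (1 < n)%N)
    (hK0 : 0 < K) (hK1 : K < 1)
    (hT : forall x y : X, p (iter n T x) (iter n T y) <= K * p x y)
    (hlambda : 0 <= lambda)
    (hKlambda : K `^ (1 / n%:R) < 1 / lambda)
    (hlambda1 : 1 / lambda < 1) :
  partial_metric_type (weighted_orbit_sum p T n lambda) /\
  (forall x y : X,
     weighted_orbit_sum p T n lambda (T x) (T y)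
       <= 1 / lambda * weighted_orbit_sum p T n lambda x y).
Proof.
(* Since [1 / 0 = 0] here, [hlambda1] alone allows [lambda = 0]; [hKlambda] excludes it, as a real
   power is nonnegative. *)
have l0 : 0 < lambda.
  by rewrite -invr_gt0 -div1r (le_lt_trans _ hKlambda) // powR_ge0.
have n0 : (0 < n)%N by exact: ltnW.
(* The left side is the [n]-th power of [lambda] times K^(1/n), a nonnegative product below 1 by
   [hKlambda]. *)
have lnK : lambda ^+ n * K <= 1.
  have -> : K = (K `^ (1 / n%:R)) ^+ n.
    rewrite -powR_mulrn ?powR_ge0 // -powRrM div1r mulVf ?powRr1 ?ltW //.
    by rewrite pnatr_eq0 -lt0n.
  rewrite -exprMn exprn_ile1 ?mulr_ge0 ?powR_ge0 //.
  by rewrite mulrC -ler_pdivlMr // ltW.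
split; first exact: partial_metric_type_weighted_orbit_sum.
move=> x y; rewrite mulrC mulrA mulr1 ler_pdivlMr // mulrC.
rewrite -(lerD2r (p x y)) weighted_orbit_sum_shift lerD2l.
apply: (@le_trans _ _ (lambda ^+ n * K * p x y)).
  by rewrite -mulrA ler_wpM2l ?exprn_ge0.
by rewrite ler_piMl // (pmt_ge0 hp).
Qed.
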